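(* Let $\mu>0$ and assume that $f-\mu\phi$ is convex. Let $\{z_k\}=\{(x_k,y_k)\}$ be generated by the AAMD algorithm described in the context, with accepted parameters $(\alpha_k,L_k)$, so that the accumulated perturbation defined by $p_{-1}=0$ and $$p_k=\frac{1}{1+\alpha_k}\,(p_{k-1}+b_k),\qquad b_k=b_k^{(1)}+b_k^{(2)}+b_k^{(3)},$$ satisfies $p_k\le 0$ for every $k$. Then for every $k\ge 0$ the Lyapunov energy $E(x,y)=D_f(x,x^\star)+\mu D_\phi(x^\star,y)$ satisfies $$E(z_{k+1})\le\Bigl(\prod_{i=0}^{k}\frac{1}{1+\alpha_i}\Bigr)E(z_0).$$
   Context: $V$ is a finite-dimensional Hilbert space with dual $V^*$ and pairing $\langle\cdot,\cdot\rangle$. $f\in C^1(V)$, and $x^\star$ is a minimizer of $f$ (so $\nabla f(x^\star)=0$). The mirror function $\phi$ is Legendre: closed, proper, strictly convex, differentiable on $\operatorname{int}\operatorname{dom}\phi$, with $\nabla\phi$ one-to-one from $\operatorname{int}\operatorname{dom}\phi$ onto $\operatorname{int}\operatorname{dom}\phi^*$, where $\phi^*$ is the Fenchel conjugate; thus $(\nabla\phi)^{-1}=\nabla\phi^*$. It is assumed throughout that $\nabla\phi(0)=0$ and $\nabla\phi^*(0)=0$. All points at which $\nabla\phi$ is evaluated, and $x^\star$, lie in $\operatorname{int}\operatorname{dom}\phi$; all points at which $\nabla\phi^*$ is evaluated lie in $\operatorname{int}\operatorname{dom}\phi^*$. The Bregman divergence of a differentiable function $h$ is $D_h(u,v)=h(u)-h(v)-\langle\nabla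 h(v),u-v\rangle$. AAMD algorithm (input $x_0,y_0$ and $\mu>0$): set $L_0=1$, $\alpha_0=1$, $p_{-1}=0$. For $k=0,1,2,\dots$: repeat the following until $p_k\le 0$: with the current trial values $\alpha_k,L_k>0$ compute $$x_{k+1}=\frac{1}{1+\alpha_k}\Bigl(x_k+\alpha_k y_k-\frac1{L_k}\nabla\phi^*(\nabla f(x_k))\Bigr),$$ $$y_{k+1}=\nabla\phi^*\Bigl(\frac{1}{1+\alpha_k}\bigl(\nabla\phi(y_k)+\alpha_k\nabla\phi(x_{k+1})-\frac{\alpha_k}{\mu}\nabla f(x_{k+1})\bigr)\Bigr),$$ and $p_k=\frac{1}{1+\alpha_k}(p_{k-1}+b_k^{(1)}+b_k^{(2)}+b_k^{(3)})$, where, with $g_k=\nabla f(x_k)$, $$b_k^{(1)}=\tfrac1{L_k}D_{\phi^*}(g_{k+1},g_k)-D_f(x_k,x_{k+1}),$$ $$b_k^{(2)}=\alpha_k\langle g_{k+1},y_k-y_{k+1}\rangle-\tfrac1{L_k}D_{\phi^*}(g_{k+1},0)-\mu D_\phi(y_{k+1},y_k),$$ $$b_k^{(3)}=-\tfrac1{L_k}D_{\phi^*}(0,g_k)-\alpha_k\mu D_\phi(y_{k+1},x_{k+1}).$$ If $p_k>0$, update the trial values using fixed constants $c_1,c_2>1$: if $b_k^{(1)}>0$, replace $L_k$ by $\max\{c_1L_k,\ D_{\phi^*}(g_{k+1},g_k)/D_f(x_k,x_{k+1})\}$; if $b_k^{(2)}>0$, replace $\alpha_k$ by $\min\{\alpha_k/c_2,\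 (\tfrac1{L_k}D_{\phi^*}(g_{k+1},0)+\mu D_\phi(y_{k+1},y_k))/\langle g_{k+1},y_k-y_{k+1}\rangle\}$; then repeat. Once $p_k\le 0$, accept $(x_{k+1},y_{k+1},\alpha_k,L_k)$ and set the next initial trial values $L_{k+1}=D_{\phi^*}(g_{k+1},g_k)/D_f(x_k,x_{k+1})$ and $\alpha_{k+1}=\sqrt{\mu/L_{k+1}}$. The sequence $\{z_k\}$ consists of the accepted iterates. *)

(* Defs.v *)
From HB Require Import structures.
From mathcomp Require Import all_boot all_order all_algebra.
From mathcomp Require Import all_classical all_reals all_analysis.

Set Implicit Arguments.
Unset Strict Implicit.
Unset Printing Implicit Defensive.

Import Order.TTheory GRing.Theory Num.Theory.
Import numFieldNormedType.Exports.

Local Open Scope classical_set_scope.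
Local Open Scope ring_scope.

HB.mixin Record NormedVector_isHilbert (R : realType) V
    & NormedModule R V & Vector R V := {
  inner : V -> V -> R ;
  innerC : forall u v : V, inner u v = inner v u ;
  innerP : forall (a : R) (u v w : V),
    inner (a *: u + v) w = a * inner u w + inner v w ;
  norm_inner : forall v : V, `|v| ^+ 2 = inner v v
}.

#[short(type="finHilbertType")]
HB.structure Definition FinHilbert (R : realType) :=
  {V of NormedVector_isHilbert R V & NormedModule R V & Vector R V}.

Definition dual (R : realType) (V : finHilbertType R) : Type := 'Hom(V, R^o).

HB.instance Definition _ (R : realType) (V : finHilbertType R) :=
  Vector.copy (dual V) 'Hom(V, R^o).

Section Dual.
Context {R : realType} {V : finHilbertType R}.
Implicit Types (xi eta : dual V) (u v w : V).

Definition pairing xi v : R := (xi : 'Hom(V, R^o)) v.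

Definition dual_norm xi : R :=
  sup [set `|pairing xi v| | v in [set v : V | `|v| <= 1]].

Lemma pairingDl xi eta v : pairing (xi + eta) v = pairing xi v + pairing eta v.
Proof. exact: add_lfunE. Qed.

Lemma pairingZl (a : R) xi v : pairing (a *: xi) v = a * pairing xi v.
Proof. exact: scale_lfunE. Qed.

Lemma pairingZr (a : R) xi v : pairing xi (a *: v) = a * pairing xi v.
Proof. exact: linearZ. Qed.

Lemma pairing0r xi : pairing xi 0 = 0.
Proof. exact: linear0. Qed.

Lemma pairing_eq0 xi : (forall v, pairing xi v = 0) -> xi = 0.
Proof. by move=> xi0; apply/lfunP => v; rewrite lfunE; exact: xi0. Qed.

Lemma inner_is_linear w : linear (inner w : V -> R^o).
Proof. by move=> a u v; rewrite innerC innerP 2!(innerC w). Qed.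

HB.instance Definition _ w := GRing.isLinear.Build R V R^o _ (inner w : V -> R^o)
  (inner_is_linear w).

Let r w : 'Hom(V, R^o) := linfun (inner w : V -> R^o).

Let r_is_linear : linear r.
Proof.
move=> a u v; apply/lfunP => w.
by rewrite add_lfunE scale_lfunE !lfunE/= innerP.
Qed.

HB.instance Definition _ := GRing.isLinear.Build R V 'Hom(V, R^o) _ r r_is_linear.

Lemma riesz xi : exists w, forall v, pairing xi v = inner w v.
Proof.
pose f : 'Hom(V, 'Hom(V, R^o)) := linfun r.
have kf : lker f = 0%VS.
  apply/eqP; rewrite -subv0; apply/subvP => w; rewrite memv_ker memv0 lfunE/=.
  move=> /eqP/lfunP/(_ w); rewrite !lfunE/= -norm_inner => /eqP.
  by rewrite sqrf_eq0 normr_eq0.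
have : (xi : 'Hom(V, R^o)) \in limg f.
  suff -> : limg f = fullv by rewrite memvf.
  apply/eqP; rewrite eqEdim subvf/= (limg_dim_eq (U:=fullv)) ?kf ?capv0//.
  by rewrite !dimvf /dim/= muln1.
move=> /memv_imgP[w _ xiE]; exists w => v.
by rewrite /pairing xiE !lfunE.
Qed.

Lemma innerDl u v w : inner (u + v) w = inner u w + inner v w.
Proof. by rewrite -[u in LHS]scale1r innerP mul1r. Qed.

Lemma inner_le w v : inner w v <= `|w| * `|v|.
Proof.
have innD u u' : `|u + u'| ^+ 2 = `|u| ^+ 2 + inner u u' *+ 2 + `|u'| ^+ 2.
  rewrite !norm_inner.
  rewrite innerDl (innerC u) (innerC u' (_ + _)) !innerDl (innerC u').
  by rewrite mulr2n !addrA.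
have : `|w + v| ^+ 2 <= (`|w| + `|v|) ^+ 2.
  by rewrite lerXn2r ?nnegrE ?addr_ge0// ler_normD.
rewrite innD sqrrD lerD2r lerD2l -[leRHS]mulr_natl -[leLHS]mulr_natl.
by rewrite ler_pM2l// ltr0n.
Qed.

Lemma pairing_bounded xi : exists M, forall v, `|pairing xi v| <= M * `|v|.
Proof.
have [w xiE] := riesz xi; exists `|w| => v; rewrite ler_norml.
apply/andP; split; last by rewrite xiE inner_le.
rewrite lerNl -mulN1r -pairingZr xiE (le_trans (inner_le _ _))//.
by rewrite scaleN1r normrN.
Qed.

Lemma dual_norm_has_sup xi :
  has_sup [set `|pairing xi v| | v in [set v : V | `|v| <= 1]].
Proof.
split; first by exists `|pairing xi 0|, 0 => //=; rewrite normr0.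
have [M xiM] := pairing_bounded xi; exists `|M| => _ [v /= v1 <-].
apply: le_trans (xiM v) (le_trans (ler_wpM2r _ (ler_norm _)) _) => //.
by rewrite ler_piMr.
Qed.

Lemma pairing_le_dual_norm xi v : `|pairing xi v| <= dual_norm xi * `|v|.
Proof.
have [->|v0] := eqVneq v 0.
  by rewrite pairing0r !normr0 mulr0.
rewrite -ler_pdivrMr ?normr_gt0//; apply: ub_le_sup.
  by case: (dual_norm_has_sup xi).
exists (`|v|^-1 *: v); last by rewrite pairingZr normrM normfV normr_id mulrC.
by rewrite /= normrZ normfV normr_id mulVf ?normr_eq0.
Qed.

Lemma dual_norm_le xi (M : R) : 0 <= M ->
  (forall v, `|pairing xi v| <= M * `|v|) -> dual_norm xi <= M.
Proof.
move=> M0 xiM; apply: ge_sup => [|_ [v /= v1 <-]].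
  by case: (dual_norm_has_sup xi).
by rewrite (le_trans (xiM v))// ler_piMr.
Qed.

Lemma dual_norm_ge0 xi : 0 <= dual_norm xi.
Proof.
apply: ub_le_sup; first by case: (dual_norm_has_sup xi).
by exists 0; rewrite /= ?pairing0r normr0.
Qed.

Lemma ler_dual_normD xi eta :
  dual_norm (xi + eta) <= dual_norm xi + dual_norm eta.
Proof.
apply: dual_norm_le => [|v]; first by rewrite addr_ge0 ?dual_norm_ge0.
by rewrite pairingDl mulrDl (le_trans (ler_normD _ _))// lerD ?pairing_le_dual_norm.
Qed.

Lemma dual_normZ_le (a : R) xi : dual_norm (a *: xi) <= `|a| * dual_norm xi.
Proof.
apply: dual_norm_le => [|v]; first by rewrite mulr_ge0 ?dual_norm_ge0.
by rewrite pairingZl normrM -mulrA ler_wpM2l ?pairing_le_dual_norm.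
Qed.

Lemma dual_normZ (a : R) xi : dual_norm (a *: xi) = `|a| * dual_norm xi.
Proof.
apply/eqP; rewrite eq_le dual_normZ_le/=.
have [->|a0] := eqVneq a 0; first by rewrite normr0 mul0r dual_norm_ge0.
rewrite -ler_pdivlMl ?normr_gt0// -normfV.
by rewrite -[leLHS]/(dual_norm xi) -[xi in leLHS](scalerK a0) dual_normZ_le.
Qed.

Lemma dual_norm_eq0 xi : dual_norm xi = 0 -> xi = 0.
Proof.
move=> xi0; apply: pairing_eq0 => v; apply/eqP; rewrite -normr_le0.
by rewrite (le_trans (pairing_le_dual_norm _ _))// xi0 mul0r.
Qed.

End Dual.

HB.instance Definition _ (R : realType) (V : finHilbertType R) :=
  Lmodule_isNormed.Build R (dual V) ler_dual_normD dual_normZ dual_norm_eq0.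

Section Gradient.
Context {R : realType} {V : finHilbertType R}.

Definition grad (h : V -> R) (v : V) : dual V := linfun ('d h v : V -> R^o).

Lemma pairing_grad (h : V -> R) (v u : V) : pairing (grad h v) u = 'd h v u.
Proof. by rewrite /pairing lfunE. Qed.

(* The differential of h at xi is an element of the bidual; V being reflexive,
   it is the evaluation at a unique vector of V, see pairing_grad_dual. *)
Definition grad_dual (h : dual V -> R) (xi : dual V) : V :=
  get [set v : V | forall eta : dual V, pairing eta v = 'd h xi eta].

Lemma pairing_grad_dual (h : dual V -> R) (xi eta : dual V) :
  pairing eta (grad_dual h xi) = 'd h xi eta.
Proof.
pose e := vbasis {:V}; pose c i : dual V := linfun (coord e i : V -> R^o).
suff [v vP] : exists v : V, forall z : dual V, pairing z v = 'd h xi z.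
  exact: (@getPex _ [set v : V | forall z : dual V, pairing z v = 'd h xi z]
    (ex_intro _ v vP)).
exists (\sum_(i < \dim {:V}) 'd h xi (c i) *: e`_i) => z.
have {2}-> : z = \sum_(i < \dim {:V}) pairing z e`_i *: c i.
  apply/lfunP => v; rewrite {1}(coord_vbasis (memvf v)) linear_sum sum_lfunE.
  apply: eq_bigr => i _; rewrite linearZ scale_lfunE lfunE/=.
  exact: mulrC.
rewrite /pairing !linear_sum; apply: eq_bigr => i _.
by rewrite !linearZ; exact: mulrC.
Qed.

Definition bregman (h : V -> R) (u v : V) : R :=
  h u - h v - pairing (grad h v) (u - v).

Definition bregman_dual (h : dual V -> R) (xi eta : dual V) : R :=
  h xi - h eta - pairing (xi - eta) (grad_dual h eta).

Definition C1 (h : V -> R) : Prop :=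
  (forall v, differentiable h v) /\ continuous (grad h).

End Gradient.

Section Legendre.
Context {R : realType}.

Definition dom {T : Type} (h : T -> \bar R) : set T := [set x | (h x < +oo)%E].

Definition int_dom {T : normedModType R} (h : T -> \bar R) : set T :=
  (dom h)°.

Definition epigraph {T : Type} (h : T -> \bar R) : set (T * R) :=
  [set z | (h z.1 <= z.2%:E)%E].

Definition proper_fun {T : Type} (h : T -> \bar R) : Prop :=
  (forall x, (-oo < h x)%E) /\ dom h !=set0.

Definition strictly_convex {T : lmodType R} (h : T -> \bar R) : Prop :=
  forall (u v : T) (t : R), dom h u -> dom h v -> u != v -> 0 < t < 1 ->
    (h (t *: u + (1 - t) *: v)%R < t%:E * h u + (1 - t)%:E * h v)%E.

Context {V : finHilbertType R}.

Definition fenchel_conjugate (phi : V -> \bar R) (xi : dual V) : \bar R :=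
  ereal_sup (range (fun v => ((pairing xi v)%:E - phi v)%E)).

Record legendre (phi : V -> \bar R) : Prop := {
  legendre_closed : closed (epigraph phi) ;
  legendre_proper : proper_fun phi ;
  legendre_strictly_convex : strictly_convex phi ;
  legendre_differentiable :
    forall v, int_dom phi v -> differentiable (fine \o phi) v ;
  legendre_bij :
    set_bij (int_dom phi) (int_dom (fenchel_conjugate phi)) (grad (fine \o phi))
}.

End Legendre.

Section AAMD.
Context {R : realType} {V : finHilbertType R}.
Variables (f : V -> R) (phi : V -> \bar R) (mu c1 c2 : R).

(* Real-valued versions of phi and of its conjugate; they are only meaningful
   on the effective domains. *)
Let phir : V -> R := fine \o phi.
Let phis : dual V -> R := fine \o fenchel_conjugate phi.

Definition next_x (x y : V) (a L : R) : V :=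
  (1 + a)^-1 *: (x + a *: y - L^-1 *: grad_dual phis (grad f x)).

Definition next_eta (x y : V) (a L : R) : dual V :=
  let x' := next_x x y a L in
  (1 + a)^-1 *: (grad phir y + a *: grad phir x' - (a / mu) *: grad f x').

Definition next_y (x y : V) (a L : R) : V :=
  grad_dual phis (next_eta x y a L).

(* In b1, b2 and b3, (x, y) is the current iterate, (x', y') the next one. *)
Definition b1 (x x' : V) (L : R) : R :=
  L^-1 * bregman_dual phis (grad f x') (grad f x) - bregman f x x'.

Definition b2 (y x' y' : V) (a L : R) : R :=
  a * pairing (grad f x') (y - y')
  - L^-1 * bregman_dual phis (grad f x') 0 - mu * bregman phir y' y.

Definition b3 (x x' y' : V) (a L : R) : R :=
  - (L^-1 * bregman_dual phis 0 (grad f x)) - a * mu * bregman phir y' x'.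

Definition next_p (q : R) (x y x' y' : V) (a L : R) : R :=
  (1 + a)^-1 * (q + (b1 x x' L + b2 y x' y' a L + b3 x x' y' a L)).

(* The trial values are positive and the trial iterate is well defined: the
   gradients of phi and of its conjugate are only taken in the interior of the
   respective domains, and the remaining argument of a divergence of the
   conjugate is in its domain. *)
Definition admissible (x y : V) (a L : R) : Prop :=
  let x' := next_x x y a L in
  [/\ 0 < a, 0 < L,
      int_dom phi y /\ int_dom phi x',
      int_dom (fenchel_conjugate phi) (grad f x) /\
        int_dom (fenchel_conjugate phi) (next_eta x y a L) &
      dom (fenchel_conjugate phi) (grad f x')].

(* The trial values (a, L) tried after the rejection of (a, L); the assignments
   are sequential, so that the update of a uses the updated value of L. *)
Definition retry (x y : V) (a L : R) : R * R :=
  let x' := next_x x y a L in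
  let y' := next_y x y a L in
  let L1 := if 0 < b1 x x' L
    then Num.max (c1 * L)
           (bregman_dual phis (grad f x') (grad f x) / bregman f x x')
    else L in
  let a1 := if 0 < b2 y x' y' a L
    then Num.min (a / c2)
           ((L1^-1 * bregman_dual phis (grad f x') 0 + mu * bregman phir y' y)
            / pairing (grad f x') (y - y'))
    else a in
  (a1, L1).

(* [backtrack q x y t t'] : from the trial values t, finitely many rejections
   lead to the trial values t'; q is the previous accumulated perturbation. *)
Inductive backtrack (q : R) (x y : V) : R * R -> R * R -> Prop :=
| backtrack_refl t : backtrack q x y t t
| backtrack_step a L t :
    admissible x y a L ->
    0 < next_p q x y (next_x x y a L) (next_y x y a L) a L ->
    backtrack q x y (retry x y a L) t ->
    backtrack q x y (a, L) t.

(* When x j.+1 = x j the quotient is 0 / 0 = 0, which is not admissible. *)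
Definition first_trial (x : nat -> V) (k : nat) : R * R :=
  if k is j.+1 then
    let L := bregman_dual phis (grad f (x j.+1)) (grad f (x j))
             / bregman f (x j) (x j.+1) in
    (Num.sqrt (mu / L), L)
  else (1, 1).

Definition prev_p (p : nat -> R) (k : nat) : R := if k is j.+1 then p j else 0.

Record aamd (x y : nat -> V) (alpha L p : nat -> R) : Prop := {
  aamd_backtrack : forall k,
    backtrack (prev_p p k) (x k) (y k) (first_trial x k) (alpha k, L k) ;
  aamd_admissible : forall k, admissible (x k) (y k) (alpha k) (L k) ;
  aamd_x : forall k, x k.+1 = next_x (x k) (y k) (alpha k) (L k) ;
  aamd_y : forall k, y k.+1 = next_y (x k) (y k) (alpha k) (L k) ;
  aamd_p : forall k, p k =
    next_p (prev_p p k) (x k) (y k) (x k.+1) (y k.+1) (alpha k) (L k) ;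
  aamd_accept : forall k, p k <= 0
}.

Definition energy (xs x y : V) : R :=
  bregman f x xs + mu * bregman phir xs y.

End AAMD.

(* Main.v *)
(* One step of the scheme satisfies [(1 + a) E' <= E + b], where [b] is the
   perturbation of that step: the update of [x] gives the decrease of [f], the
   three-point identity of Bregman divergences together with the update of [y]
   gives that of the divergence of [phi], and the two are linked by
   [mu * D_phi xs x' <= D_f xs x'], i.e. by the convexity of [f - mu phi]. Hence
   [E - p] contracts by [1 / (1 + a)] at each step, and [p <= 0].
   The update of [y] is only known through [y' = grad phi^* eta]; that
   [grad phi y' = eta] rests on the differentiability of [phi^*] in the interior
   of its domain, which has to be derived from the Legendre property of [phi]. *)
From HB Require Import structures.
Require Import Defs.
From mathcomp Require Import all_boot all_order all_algebra.
From mathcomp Require Import all_classical all_reals all_analysis.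
From mathcomp Require Import ring lra.

Set Implicit Arguments.
Unset Strict Implicit.
Unset Printing Implicit Defensive.

Import Order.TTheory GRing.Theory Num.Theory.
Import numFieldNormedType.Exports.

Local Open Scope classical_set_scope.
Local Open Scope ring_scope.

Lemma segment_subr {R : pzRingType} {W : lmodType R} (u v : W) (t : R) :
  t *: u + (1 - t) *: v - v = t *: (u - v).
Proof. by rewrite scalerBl scale1r addrCA addrAC subrr add0r scalerBr. Qed.

(** * Differentials of real functions under convexity and at minimizers *)

Section Differential.
Context {R : realType} {W : normedModType R}.
Implicit Types (h : W -> R) (u v w : W).

(** The right difference quotients at [0 < t < 1] are at most [c], and the bound survives the limit
    from the right. *)
Lemma diff_le_slope h v w (c : R) : differentiable h v ->
  (forall t : R, 0 < t < 1 -> h (v + t *: w) - h v <= t * c) ->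
  'd h v w <= c.
Proof.
move=> dh hc; rewrite -deriveE//.
have /cvg_dnbhs_at_right /= dvg := @diff_derivable _ _ _ _ _ w dh.
apply: (cvgr_to_le dvg); near=> t.
have t0 : 0 < t by near: t; exact: nbhs_right_gt.
have t1 : t < 1 by near: t; exact: nbhs_right_lt.
rewrite /= [_ *: _]mulrC ler_pdivrMr// mulrC [t *: w + v]addrC.
by apply: hc; rewrite t0.
Unshelve. all: by end_near. Qed.

Lemma diff_le_convex h u v : differentiable h v ->
  (forall t : R, 0 < t < 1 ->
    h (t *: u + (1 - t) *: v) <= t * h u + (1 - t) * h v) ->
  'd h v (u - v) <= h u - h v.
Proof.
move=> dh hc; apply: diff_le_slope => // t t01.
have -> : v + t *: (u - v) = t *: u + (1 - t) *: v.
  by rewrite -segment_subr addrC subrK.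
have := hc _ t01; lra.
Qed.

Lemma diff_minimizer h v w : differentiable h v -> (forall u, h v <= h u) ->
  'd h v w = 0.
Proof.
move=> dh hv; have dhN : differentiable (- h) v by exact: differentiableN.
(* The slope bound for [- h] with [c = 0] holds in every direction; the opposite direction then
   gives the reverse inequality. *)
have dh_ge0 z : 0 <= 'd h v z.
  have := @diff_le_slope (- h) v z 0 dhN; rewrite diffN//= oppr_le0; apply.
  move=> t _; rewrite mulr0 -[(- h) _]/(- h _) -[(- h) v]/(- h v) opprK.
  by rewrite addrC subr_le0.
apply/eqP; rewrite eq_le dh_ge0 andbT -oppr_ge0.
by have := dh_ge0 (- w); rewrite linearN.
Qed.

End Differential.

(** * Pairing, bidual and compactness in finite dimension *)

Section FiniteDimension.
Context {R : realType} {V : finHilbertType R}.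

Lemma pairing0l (v : V) : pairing 0 v = 0.
Proof. exact: zero_lfunE. Qed.

Lemma pairingNl (xi : dual V) v : pairing (- xi) v = - pairing xi v.
Proof. exact: opp_lfunE. Qed.

Lemma pairingDr (xi : dual V) u v :
  pairing xi (u + v) = pairing xi u + pairing xi v.
Proof. exact: linearD. Qed.

Lemma pairingBl (xi eta : dual V) v :
  pairing (xi - eta) v = pairing xi v - pairing eta v.
Proof. by rewrite pairingDl pairingNl. Qed.

Lemma pairingNr (xi : dual V) v : pairing xi (- v) = - pairing xi v.
Proof. exact: linearN. Qed.

Lemma pairingBr (xi : dual V) u v :
  pairing xi (u - v) = pairing xi u - pairing xi v.
Proof. by rewrite pairingDr pairingNr. Qed.

(** The image of [v] in the bidual, which will be the differential of the conjugate at the gradient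
    at [v]. *)
Definition evaluation (v : V) (xi : dual V) : R^o := pairing xi v.

Lemma evaluation_is_linear v : linear (evaluation v).
Proof. by move=> a xi eta; rewrite /evaluation pairingDl pairingZl. Qed.

HB.instance Definition _ v :=
  GRing.isLinear.Build R (dual V) R^o _ (evaluation v) (evaluation_is_linear v).

Lemma evaluation_continuous v : continuous (evaluation v).
Proof.
apply: bounded_linear_continuous; apply/linear_boundedP.
near=> r => xi; apply: le_trans (pairing_le_dual_norm xi v) _.
rewrite mulrC ler_wpM2r ?dual_norm_ge0//.
Unshelve. all: by end_near. Qed.

(** Testing with the functional [inner (u - v)] shows that the squared norm of [u - v] vanishes. *)
Lemma pairing_inj (u v : V) :
  (forall xi : dual V, pairing xi u = pairing xi v) -> u = v.
Proof.
move=> uv; apply/eqP; rewrite -subr_eq0 -normr_eq0 -sqrf_eq0 norm_inner.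
have := uv (linfun (inner (u - v) : V -> R^o)).
rewrite /pairing !lfunE/= => uvE.
have /= -> := linearB (inner (u - v) : {linear V -> R^o}) u v.
by rewrite uvE subrr.
Qed.

(** Coordinates in a basis are bounded linear forms, so [A] is a closed subset of the continuous
    image of a compact box of row vectors. *)
Lemma closed_bounded_compact (A : set V) (M : R) :
  closed A -> (forall v, A v -> `|v| <= M) -> compact A.
Proof.
move=> Acl AM; pose e := vbasis {:V}.
pose c (r : 'rV[R]_(\dim {:V})) : V := \sum_i r ord0 i *: e`_i.
have cc : continuous c.
  rewrite /c; elim: (index_enum _) => [|i s IHs].
    by under eq_fun do rewrite big_nil; exact: cst_continuous.
  under eq_fun do rewrite big_cons.
  by move=> r; apply: cvgD (IHs r); apply: cvgZr_tmp; exact: coord_continuous.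
have /choice[B BP] : forall i : 'I_(\dim {:V}), exists B : R,
    forall v, `|coord e i v| <= B * `|v|.
  move=> i; have [B BP] := pairing_bounded (linfun (coord e i : V -> R^o) : dual V).
  by exists B => v; have := BP v; rewrite /pairing lfunE.
pose K := [set r : 'rV[R]_(\dim {:V}) |
  forall i, `[- (`|B i| * M), `|B i| * M]%classic (r ord0 i)].
have cK : compact K.
  apply: (@rV_compact R _ (fun i => `[- (`|B i| * M), `|B i| * M]%classic)) => i.
  exact: segment_compact.
have cKc : compact (c @` K).
  by apply: continuous_compact cK; exact: continuous_subspaceT.
apply: subclosed_compact Acl cKc _.
move=> v Av; exists (\row_i coord e i v) => [i|].
  rewrite /= mxE in_itv/= -ler_norml (le_trans (BP i v))//.
  rewrite (le_trans (ler_wpM2r _ (ler_norm _)))//.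
  by rewrite ler_wpM2l// AM.
rewrite [RHS](coord_vbasis (memvf v)).
by apply: eq_bigr => i _; rewrite mxE.
Qed.

End FiniteDimension.

(** * Legendre functions and the inversion of their gradient *)

Section Legendre.
Context {R : realType} {V : finHilbertType R} {phi : V -> \bar R}.
Context (phiL : legendre phi).

Let phir : V -> R := fine \o phi.
Let phis : dual V -> R := fine \o fenchel_conjugate phi.

Lemma legendre_fineK v : dom phi v -> (phir v)%:E = phi v.
Proof.
move=> domv; apply: fineK; rewrite fin_real// domv andbT.
by case: (legendre_proper phiL).
Qed.

Lemma legendre_lt u v (t : R) : dom phi u -> dom phi v -> u != v -> 0 < t < 1 ->
  dom phi (t *: u + (1 - t) *: v) /\
  phir (t *: u + (1 - t) *: v) < t * phir u + (1 - t) * phir v.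
Proof.
move=> domu domv uv t01.
have := legendre_strictly_convex phiL domu domv uv t01.
rewrite -(legendre_fineK domu) -(legendre_fineK domv) -!EFinM -EFinD => lt_uv.
have dom_uv : dom phi (t *: u + (1 - t) *: v).
  by rewrite /dom/= (lt_trans lt_uv)// ltry.
by move: lt_uv; rewrite -(legendre_fineK dom_uv) lte_fin.
Qed.

(** Adds the cases [u = v] and [t = 1], which strict convexity leaves out. *)
Lemma legendre_le u v (t : R) : dom phi u -> dom phi v -> 0 < t <= 1 ->
  dom phi (t *: u + (1 - t) *: v) /\
  phir (t *: u + (1 - t) *: v) <= t * phir u + (1 - t) * phir v.
Proof.
move=> domu domv /andP[t0]; rewrite le_eqVlt => /predU1P[->|t1].
  by rewrite subrr scale0r addr0 scale1r mul1r mul0r addr0.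
have [->|uv] := eqVneq u v.
  by rewrite -scalerDl addrC subrK scale1r -mulrDl addrC subrK mul1r.
have t01 : 0 < t < 1 by rewrite t0.
by have [? /ltW] := legendre_lt domu domv uv t01.
Qed.

Lemma int_dom_dom v : int_dom phi v -> dom phi v.
Proof. exact: interior_subset. Qed.

Lemma legendre_bregman_ge0 u v : dom phi u -> int_dom phi v ->
  0 <= bregman phir u v.
Proof.
move=> domu domv; rewrite /bregman pairing_grad subr_ge0.
apply: diff_le_convex => [|t /andP[t0 t1]].
  exact: (legendre_differentiable phiL domv).
by have [|//] := @legendre_le u v t domu (int_dom_dom domv); rewrite t0 ltW.
Qed.

(** The divergence from [v] is convex in its first argument and vanishes at [v]. *)
Lemma legendre_bregman_segment u v (t : R) :
  dom phi u -> int_dom phi v -> 0 < t <= 1 ->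
  bregman phir (t *: u + (1 - t) *: v) v <= t * bregman phir u v.
Proof.
move=> domu domv t01.
have [_] := legendre_le domu (int_dom_dom domv) t01.
by rewrite /bregman segment_subr pairingZr; lra.
Qed.

(** At the midpoint the divergence is nonnegative, and by strict convexity it is less than half of
    its value at [u]. *)
Lemma legendre_bregman_gt0 u v : dom phi u -> int_dom phi v -> u != v ->
  0 < bregman phir u v.
Proof.
move=> domu domv uv.
have t01 : 0 < (2^-1 : R) < 1 by lra.
have [domm ltm] := legendre_lt domu (int_dom_dom domv) uv t01.
have := legendre_bregman_ge0 domm domv.
by rewrite {1}/bregman segment_subr pairingZr /bregman; lra.
Qed.

(* Strict convexity makes the divergence bounded below on a small sphere around
   [v], and convexity propagates the bound linearly to the outside. *)
Lemma legendre_bregman_growth v (e : R) : int_dom phi v -> 0 < e ->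
  exists2 m : R, 0 < m & forall u, dom phi u -> e <= `|u - v| ->
    m * `|u - v| <= bregman phir u v.
Proof.
move=> domv e0.
have [d [d0 de dP]] : exists d : R, [/\ 0 < d, d <= e &
    forall w, `|w - v| = d -> int_dom phi w].
  have /nbhs_ballP[r /= r0 rP] : nbhs v (int_dom phi).
    exact: nbhs_interior.
  (* Halving [r] keeps the sphere inside the open ball of radius [r]. *)
  exists (Num.min e (r / 2)); split.
  - by rewrite lt_min e0/= divr_gt0.
  - by rewrite ge_min lexx.
  - move=> w wv; apply: rP; rewrite -ball_normE/= distrC wv.
    by rewrite gt_min [X in _ || X](_ : _ = true) ?orbT//; apply/idP; lra.
pose S := [set w | `|w - v| = d].
have [m m0 mP] : exists2 m : R, 0 < m & forall w, S w -> m <= bregman phir w v.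
  (* The sphere is empty when [V] is trivial, and then any positive constant will do. *)
  have [[w0 Sw0]|S0] := pselect (S !=set0); last first.
    by exists 1 => // w Sw; exfalso; apply: S0; exists w.
  have Scl : closed S.
    apply: (@closed_comp _ _ (fun w : V => `|w - v|) [set d]) => [w _|].
      by apply: cvg_norm; apply: cvgB; [exact: cvg_id|exact: cvg_cst].
    exact: closed_eq.
  have Scomp : compact S.
    apply: (@closed_bounded_compact _ _ _ (d + `|v|) Scl) => w Sw.
    by rewrite -Sw -[in leLHS](subrK v w) ler_normD.
  have Bc : {within S, continuous (fun w => bregman phir w v)}.
    apply: continuous_in_subspaceT => w /set_mem /dP domw.
    have dw := legendre_differentiable phiL domw.
    have pc : {for w, continuous (fun u : V => pairing (grad phir v) (u - v))}.
      apply: (@continuous_comp _ _ _ (fun w : V => w - v) (pairing (grad phir v))).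
        by apply: cvgB; [exact: cvg_id|exact: cvg_cst].
      have -> : pairing (grad phir v) = 'd phir v.
        by apply/funext => u; rewrite pairing_grad.
      exact/diff_continuous/(legendre_differentiable phiL domv).
    apply: continuousB pc; apply: continuousB; last exact: cst_continuous.
    exact: differentiable_continuous.
  have [c /set_mem Sc cmin] := compact_EVT_min (ex_intro _ _ Sw0) Scomp Bc.
  exists (bregman phir c v); last by move=> w Sw; apply: cmin; exact: mem_set.
  apply: legendre_bregman_gt0 => //; first exact/int_dom_dom/dP.
  by rewrite -subr_eq0 -normr_eq0 Sc gt_eqF.
exists (m / d); first by rewrite divr_gt0.
move=> u domu eu; have u0 : 0 < `|u - v| by exact: lt_le_trans eu.
(* With this [t], the point at parameter [t] on the segment from [v] to [u] lies on the sphere. *)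
pose t := d / `|u - v|.
have t0 : 0 < t by rewrite divr_gt0.
have t01 : 0 < t <= 1 by rewrite t0/= ler_pdivrMr// mul1r (le_trans de).
have Su : S (t *: u + (1 - t) *: v).
  by rewrite /S/= segment_subr normrZ gtr0_norm// divfK// gt_eqF.
have := le_trans (mP _ Su) (legendre_bregman_segment domu domv t01).
by rewrite -ler_pdivrMl// /t invf_div mulrC mulrA -mulrA [_ / d]mulrC mulrA.
Qed.

(** The equality case of Fenchel-Young: since divergences from [v] are nonnegative, the supremum
    defining the conjugate is attained at [v]. *)
Lemma legendre_conjugate_grad v : int_dom phi v ->
  fenchel_conjugate phi (grad phir v) = (pairing (grad phir v) v - phir v)%:E.
Proof.
move=> domv; apply/eqP; rewrite eq_le; apply/andP; split; last first.
  apply: ereal_sup_ubound; exists v => //.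
  by rewrite -legendre_fineK//; exact: int_dom_dom.
apply: ge_ereal_sup => _ [u _ <-].
have [domu|] := boolP (phi u < +oo)%E; last first.
  by rewrite ltey negbK => /eqP ->; rewrite addeNy leNye.
rewrite -(legendre_fineK domu) /= lee_fin.
have := legendre_bregman_ge0 domu domv.
rewrite /bregman pairingDr pairingNr; lra.
Qed.

(* The conjugate is differentiable because the inverse of the gradient is
   continuous at [eta]: if [z + eta] is the gradient at [u] and [z] is small, then
   the growth of the divergence of [u] from [v] forces [u] to be close to [v]. *)
Lemma legendre_conjugate_diff v xi : int_dom phi v ->
  int_dom (fenchel_conjugate phi) (grad phir v) ->
  'd phis (grad phir v) xi = pairing xi v.
Proof.
move=> domv dom_eta; set eta := grad phir v.
suff -> : 'd phis eta = evaluation v :> (dual V -> R^o) by [].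
apply: diff_unique; first exact: evaluation_continuous.
apply/eqaddoP => e e0.
(* The accuracy [e] of the remainder also serves as the radius from which the growth bound applies;
   [z] is then taken of norm below [m]. *)
have [m m0 mP] := legendre_bregman_growth domv e0.
have near_dom : \forall z \near (0 : dual V),
    int_dom (fenchel_conjugate phi) (eta + z).
  by have /nbhs0P := nbhs_interior dom_eta.
near=> z.
have : int_dom (fenchel_conjugate phi) (eta + z) by near: z.
have [_ _ surj] := legendre_bij phiL.
move=> /surj[u domu uE].
have zm : `|z| < m by near: z; exact: nbhs0_lt.
rewrite -[X in `|X|]/(phis (z + eta) - (phis eta + pairing z v)).
have phisE w : int_dom phi w ->
    phis (grad phir w) = pairing (grad phir w) w - phir w.
  by move=> domw; rewrite /phis /= legendre_conjugate_grad.
have zuv (w : V) : `|pairing z w| <= `|z| * `|w| by exact: pairing_le_dual_norm.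
have XE : phis (z + eta) - (phis eta + pairing z v) =
    pairing z (u - v) - bregman phir u v.
  rewrite addrC addrC [z + eta]addrC -uE phisE// uE phisE// /bregman.
  rewrite pairingDl !pairingDr !pairingNr -/eta; ring.
(* The remainder is the divergence of [v] from [u]. *)
have X0 : 0 <= pairing z (u - v) - bregman phir u v.
  have := legendre_bregman_ge0 (int_dom_dom domv) domu.
  rewrite /bregman uE pairingDl !pairingDr !pairingNr -/eta; lra.
have uv_lt : `|u - v| < e.
  rewrite ltNge; apply/negP => euv.
  have := mP _ (int_dom_dom domu) euv.
  have : `|z| * `|u - v| < m * `|u - v| by rewrite ltr_pM2r// (lt_le_trans e0).
  have := zuv (u - v); rewrite ler_norml => /andP[_]; lra.
rewrite XE ger0_norm// mulrC (le_trans (y := pairing z (u - v)))//.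
  by rewrite gerBl legendre_bregman_ge0//; exact: int_dom_dom.
rewrite (le_trans (ler_norm _))// (le_trans (zuv _))//.
by rewrite ler_wpM2l// ltW.
Unshelve. all: by end_near. Qed.

Lemma legendre_grad_conjugate_grad v : int_dom phi v ->
  int_dom (fenchel_conjugate phi) (grad phir v) ->
  grad_dual phis (grad phir v) = v.
Proof.
move=> domv dom_eta; apply: pairing_inj => xi.
by rewrite pairing_grad_dual legendre_conjugate_diff.
Qed.

(** Every point of the interior is some [grad phir v], which [grad_dual phis] sends back to [v].
    This turns the update of [y] into an equation for [grad phir y']. *)
Lemma legendre_grad_dualK eta : int_dom (fenchel_conjugate phi) eta ->
  int_dom phi (grad_dual phis eta) /\ grad phir (grad_dual phis eta) = eta.
Proof.
have [_ _ surj] := legendre_bij phiL.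
move=> /[dup] dom_eta /surj[v domv vE]; rewrite -vE in dom_eta *.
by rewrite legendre_grad_conjugate_grad.
Qed.

End Legendre.

(** * One-step estimate of the energy *)

Section AAMD.
Context {R : realType} {V : finHilbertType R}.
Context (f : V -> R) (phi : V -> \bar R) (mu : R).

Let phir : V -> R := fine \o phi.
Let phis : dual V -> R := fine \o fenchel_conjugate phi.

Lemma bregman_split (h : V -> R) (u v : V) : bregman h u v =
  h u - h v - (pairing (grad h v) u - pairing (grad h v) v).
Proof. by rewrite /bregman pairingBr. Qed.

Lemma bregman_three_point (h : V -> R) (u v w : V) :
  bregman h u w = bregman h u v + bregman h v w
    + (pairing (grad h v) (u - v) - pairing (grad h w) (u - v)).
Proof. by rewrite !bregman_split !(pairingBr _ u v); ring. Qed.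

(** Gathers the conjugate divergences of [b1], [b2] and [b3] into the single pairing produced by the
    update of [x]. *)
Lemma bregman_dual_three_point (h : dual V -> R) (xi eta : dual V) :
  grad_dual h 0 = 0 ->
  bregman_dual h xi eta - bregman_dual h xi 0 - bregman_dual h 0 eta =
  - pairing xi (grad_dual h eta).
Proof.
move=> h0; rewrite /bregman_dual h0 !pairingDl !pairingNl !pairing0l !pairing0r.
ring.
Qed.

Lemma bregman_minimizer (u xs : V) : differentiable f xs ->
  (forall v, f xs <= f v) -> bregman f u xs = f u - f xs.
Proof.
by move=> df fmin; rewrite /bregman pairing_grad diff_minimizer// subr0.
Qed.

(** This is the first-order inequality for the convex function [f - mu phi], since divergences are
    linear in the function. *)
Lemma bregman_rel_convex (u v : V) : differentiable f v -> legendre phi ->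
  convex_function (dom phi) (fun v : V => f v - mu * fine (phi v)) ->
  dom phi u -> int_dom phi v -> mu * bregman phir u v <= bregman f u v.
Proof.
move=> df phiL fphi domu domv.
have dphi : differentiable phir v by exact: (legendre_differentiable phiL domv).
have dmphi : differentiable (mu *: phir) v by exact: differentiableZ.
have dh : 'd (f - mu *: phir) v =
    ('d f v : V -> R) \- mu \*: ('d phir v : V -> R) :> (V -> R).
  by rewrite diffB// diffZ.
have := @diff_le_convex _ _ (f - mu *: phir) u v (differentiableB df dmphi).
rewrite dh => H.
have {H} : 'd f v (u - v) - mu * 'd phir v (u - v)
    <= (f u - mu * phir u) - (f v - mu * phir v).
  apply: H => t /andP[t0 t1].
  exact: fphi (Itv01 (ltW t0) (ltW t1)) u v (mem_set domu)
    (mem_set (int_dom_dom domv)).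
rewrite /bregman (pairing_grad f) (pairing_grad phir).
move: ('d f v (u - v)) ('d phir v (u - v)) (f u) (f v) (phir u) (phir v) => *; lra.
Qed.

(* Each variable stands for a term of the energy estimate: [f] values are [v_],
   pairings with the gradient at the new point are [g_], divergences are [D_]. *)
Lemma energy_arith (F : realFieldType) (a m li vx vx' vs Ex Ex' gx gx' gy gy' gs gp
    gsy' gyy' P Q S Dxx' Dsx' Dsy Dsy' Dsx'phi Dy'y Dy'x' D1 D2 D3 : F) :
  0 < a -> 0 < m ->
  Ex = vx - vs -> Ex' = vx' - vs ->
  gsy' = gs - gy' -> gyy' = gy - gy' ->
  Dxx' = vx - vx' - (gx - gx') -> Dsx' = vs - vx' - (gs - gx') ->
  a * (gy - gx') - li * gp = gx' - gx ->
  (1 + a) * P = Q + a * S - a / m * gsy' ->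
  D1 - D2 - D3 = - gp ->
  Dsy = Dsy' + Dy'y + (P - Q) ->
  Dsx'phi = Dsy' + Dy'x' + (P - S) ->
  m * Dsx'phi <= Dsx' ->
  (1 + a) * (Ex' + m * Dsy') <= Ex + m * Dsy +
    (li * D1 - Dxx' + (a * gyy' - li * D2 - m * Dy'y)
      + (- (li * D3) - a * m * Dy'x')).
Proof.
move=> a0 m0 -> -> gsy'E -> -> -> xE yE dE -> -> rel.
(* Scaling the [y] update by [m], the dual identity by [li] and the relative convexity bound by [a]
   makes all terms match; the rest is linear. *)
have {}yE : m * ((1 + a) * P) = m * Q + m * a * S - a * (gs - gy').
  by rewrite yE gsy'E; field; rewrite gt_eqF.
have {}dE := congr1 ( *%R li) dE.
have := ler_wpM2l (ltW a0) rel; lra.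
Qed.

Lemma energy_step (xs x y x' y' : V) (a L : R) : C1 f -> (forall v, f xs <= f v) ->
  legendre phi -> int_dom phi xs -> grad_dual phis 0 = 0 -> 0 < mu ->
  convex_function (dom phi) (fun v : V => f v - mu * fine (phi v)) ->
  admissible f phi mu x y a L ->
  x' = next_x f phi x y a L -> y' = next_y f phi mu x y a L ->
  (1 + a) * energy f phi mu xs x' y' <=
  energy f phi mu xs x y
    + (b1 f phi x x' L + b2 f phi mu y x' y' a L + b3 f phi mu x x' y' a L).
Proof.
move=> [df _] fmin phiL domxs phis0 mu0 fphi.
move=> [a0 L0 [domy domx'] [_ dom_eta] _] x'E y'E.
have a1 : 1 + a != 0 by rewrite gt_eqF// addr_gt0.
have [domy' grady'] := legendre_grad_dualK phiL dom_eta.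
rewrite -/(next_y f phi mu x y a L) -y'E in domy' grady'.
rewrite -x'E in domx'; set g' := grad f x'.
(* The update of [x], cleared of its denominator and paired with the gradient at the new point. *)
have pairing_x' : a * (pairing g' y - pairing g' x')
    - L^-1 * pairing g' (grad_dual phis (grad f x)) = pairing g' x' - pairing g' x.
  have x'S : (1 + a) *: x' = x + a *: y - L^-1 *: grad_dual phis (grad f x).
    by rewrite x'E /next_x scalerA divff// scale1r.
  have := congr1 (pairing g') x'S.
  rewrite pairingZr pairingBr pairingDr !pairingZr.
  move: (pairing g' _) (pairing g' _) (pairing g' _) (pairing g' _) => *; lra.
(* The update of [y] in gradient form; it is used below at [xs - y']. *)
have pairing_y' w : (1 + a) * pairing (grad phir y') w =
    pairing (grad phir y) w + a * pairing (grad phir x') w - a / mu * pairing g' w.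
  rewrite grady' /next_eta -x'E pairingZl mulrA divff// mul1r.
  by rewrite [LHS]pairingBl [X in X - _]pairingDl [X in _ + X - _]pairingZl
    [X in _ - X]pairingZl.
refine (energy_arith a0 mu0 (bregman_minimizer x (df xs) fmin)
  (bregman_minimizer x' (df xs) fmin) (pairingBr g' xs y') (pairingBr g' y y')
  (bregman_split f x x') (bregman_split f xs x') pairing_x'
  (pairing_y' (xs - y')) (bregman_dual_three_point g' (grad f x) phis0)
  (bregman_three_point phir xs y' y) (bregman_three_point phir xs y' x') _).
exact: (bregman_rel_convex (df x') phiL fphi (int_dom_dom domxs) domx').
Qed.

End AAMD.

Theorem theorem4p2 (R : realType) (V : finHilbertType R)
    (f : V -> R) (phi : V -> \bar R) (xstar : V) (mu c1 c2 : R)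
    (x y : nat -> V) (alpha L p : nat -> R)
    (f_C1 : C1 f)
    (xstar_min : forall v : V, f xstar <= f v)
    (phi_legendre : legendre phi)
    (dom_xstar : int_dom phi xstar)
    (dom_0 : int_dom phi 0)
    (grad_phi_0 : grad (fine \o phi) 0 = 0)
    (dom_conj_0 : int_dom (fenchel_conjugate phi) 0)
    (grad_conj_0 : grad_dual (fine \o fenchel_conjugate phi) 0 = 0)
    (mu_gt0 : 0 < mu) (c1_gt1 : 1 < c1) (c2_gt1 : 1 < c2)
    (f_rel_convex :
      convex_function (dom phi) (fun v : V => f v - mu * fine (phi v)))
    (aamd_xy : aamd f phi mu c1 c2 x y alpha L p) :
  forall k : nat,
    energy f phi mu xstar (x k.+1) (y k.+1) <=
    (\prod_(i < k.+1) (1 / (1 + alpha i))) * energy f phi mu xstar (x 0%N) (y 0%N).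
Proof.
pose E k := energy f phi mu xstar (x k) (y k).
have a0 k : 0 < alpha k by case: (aamd_admissible aamd_xy k).
(* By the recursion for [p k], subtracting the accumulated perturbation from the energy absorbs the
   perturbation of the current step. *)
have step k : E k.+1 - p k <= (1 + alpha k)^-1 * (E k - prev_p p k).
  have := energy_step f_C1 xstar_min phi_legendre dom_xstar grad_conj_0 mu_gt0
    f_rel_convex (aamd_admissible aamd_xy k) (aamd_x aamd_xy k) (aamd_y aamd_xy k).
  rewrite ler_pdivlMl ?addr_gt0// (aamd_p aamd_xy k) /next_p mulrBr mulVKf.
    by rewrite -/(E _) -/(E _); lra.
  by rewrite gt_eqF// addr_gt0.
(* The index is shifted: [prev_p p k] is what has accumulated before step [k], and it is zero at
   [k = 0]. *)
have bound k : E k - prev_p p k <= \prod_(i < k) (1 / (1 + alpha i)) * E 0%N.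
  elim: k => [|k IHk]; first by rewrite big_ord0 mul1r subr0.
  rewrite (le_trans (step k))// big_ord_recr/= div1r [_ * (1 + _)^-1]mulrC -mulrA.
  by rewrite ler_pM2l ?invr_gt0 ?addr_gt0.
move=> k; apply: le_trans (bound k.+1).
by rewrite lerDl oppr_ge0; exact: (aamd_accept aamd_xy k).
Qed.
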